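(* Let $\alpha,\beta$ be real numbers with $0\le\alpha\le\beta$. For every $f\in C([0,1])$, the sequence $\left(B_n^{\alpha,\beta}(f;\cdot)\right)_{n\in\mathbb{N}}$ converges uniformly to $f$ in $[0,1]$.
   Context: $C([0,1])$ denotes the set of continuous functions $f:[0,1]\to\mathbb{R}$, and $\mathbb{N}=\{1,2,3,\ldots\}$. For real numbers $0\le\alpha\le\beta$, $n\in\mathbb{N}$, $f:[0,1]\to\mathbb{R}$ and $x\in[0,1]$, the Bernstein-Stancu operator is $$B_n^{\alpha,\beta}(f;x)=\sum_{k=0}^n b_{n,k}(x)\,f\left(\frac{k+\alpha}{n+\beta}\right),\qquad b_{n,k}(x)=\binom{n}{k}x^k(1-x)^{n-k}.$$ *)

(* Defs.v *)
From HB Require Import structures.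
From mathcomp Require Import all_boot all_order all_algebra.
From mathcomp Require Import all_classical all_reals all_analysis.
Set Implicit Arguments.
Unset Strict Implicit.
Unset Printing Implicit Defensive.
Import Order.TTheory GRing.Theory Num.Theory.
Import numFieldNormedType.Exports.
Local Open Scope classical_set_scope.
Local Open Scope ring_scope.

Definition bernstein_basis (R : realType) (n k : nat) (x : R) : R :=
  'C(n, k)%:R * x ^+ k * (1 - x) ^+ (n - k).

(* The operator only reads [f] at the nodes (k + alpha) / (n + beta), which lie
   in [0, 1] when 0 <= alpha <= beta and n >= 1; this is why a function on
   [0, 1] can be represented by a total function on [R].  The formula is not
   meaningful for n = 0, beta = 0, where the denominator vanishes. *)
Definition bernstein_stancu (R : realType) (alpha beta : R) (n : nat)
    (f : R -> R) (x : R) : R :=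
  \sum_(k < n.+1)
    bernstein_basis n k x * f ((k%:R + alpha) / (n%:R + beta)).

(* Main.v *)
Require Import Defs.
From HB Require Import structures.
From mathcomp Require Import all_boot all_order all_algebra.
From mathcomp Require Import all_classical all_reals all_analysis.
From mathcomp Require Import ring lra.
Import Order.TTheory GRing.Theory Num.Theory.
Import numFieldNormedType.Exports.
Local Open Scope classical_set_scope.
Local Open Scope ring_scope.

(** By uniform continuity and boundedness of [f] on [0, 1], for every [e > 0]
    there is [C] with [|f x - f t| <= e + C (x - t)^2] for all [x, t] in [0, 1].
    Applying the positive operator, which preserves constants, reduces the
    claim to the second moment of the nodes about [x]: with
    [c = (n + beta) x - alpha], it equals
    [(n + beta)^-2 * \sum_k b_(n,k)(x) (k - c)^2
     = (n x (1 - x) + (alpha - beta x)^2) / (n + beta)^2 = O(1/n)]. *)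

(** Pascal's rule, summed against a weight [g]. It is the recursion in [n] behind both moment
    computations below. *)
Lemma sum_bernstein_basisS {R : realType} (n : nat) (x : R) (g : nat -> R) :
  \sum_(k < n.+2) bernstein_basis n.+1 k x * g k =
  (1 - x) * (\sum_(k < n.+1) bernstein_basis n k x * g k) +
  x * (\sum_(k < n.+1) bernstein_basis n k x * g k.+1).
Proof.
have pascal (k : nat) : bernstein_basis n.+1 k.+1 x =
    'C(n, k.+1)%:R * x ^+ k.+1 * (1 - x) ^+ (n - k) + x * bernstein_basis n k x.
  rewrite /bernstein_basis binS subSS natrD exprS; ring.
rewrite big_ord_recl [in RHS]big_ord_recl /= /bump /=.
under eq_bigr do rewrite add1n pascal mulrDl.
under [in RHS]eq_bigr do rewrite add1n.
(* The last term, [k = n], carries ['C(n, n.+1) = 0]; the other terms match the tail of the first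
   sum on the right. *)
rewrite big_split /= big_ord_recr /= bin_small // !mul0r addr0.
rewrite mulrDr !mulr_sumr addrA; congr (_ + _ + _).
- by rewrite /bernstein_basis !bin0 !subn0 exprS; ring.
- apply: eq_bigr => k _.
  by rewrite /bernstein_basis -(subnSK (ltn_ord k)) [_ ^+ (n - _).+1]exprS; ring.
- by apply: eq_bigr => k _; rewrite mulrA.
Qed.

Lemma sum_bernstein_basis {R : realType} (n : nat) (x : R) :
  \sum_(k < n.+1) bernstein_basis n k x = 1.
Proof.
elim: n => [|n IH].
  by rewrite big_ord1 /bernstein_basis bin0 !expr0 !mulr1.
have /= := sum_bernstein_basisS n x (fun=> 1).
under eq_bigr do rewrite mulr1.
under [X in _ * X + _]eq_bigr do rewrite mulr1.
under [X in _ + x * X]eq_bigr do rewrite mulr1.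
by move=> ->; rewrite IH; ring.
Qed.

(* The centre [c] is kept arbitrary because the induction on [n] passes from
   [c] to [c - 1]. *)
Lemma sum_bernstein_basis_sqr {R : realType} (n : nat) (x c : R) :
  \sum_(k < n.+1) bernstein_basis n k x * (k%:R - c) ^+ 2 =
  n%:R * x * (1 - x) + (n%:R * x - c) ^+ 2.
Proof.
elim: n c => [|n IH] c.
  by rewrite big_ord1 /bernstein_basis /= bin0 subn0 !expr0; ring.
rewrite (sum_bernstein_basisS n x (fun k => (k%:R - c) ^+ 2)) IH.
under eq_bigr do rewrite -natr1 -addrA -[1 - c]opprB.
by rewrite IH -natr1; ring.
Qed.

Lemma bernstein_basis_ge0 {R : realType} (n k : nat) {x : R} :
  0 <= x <= 1 -> 0 <= bernstein_basis n k x.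
Proof.
by move=> /andP[x0 x1]; rewrite !mulr_ge0 ?exprn_ge0 ?subr_ge0.
Qed.

(** Heine-Cantor. By the near-covering form of compactness, it is enough to find around each point
    of [K] a neighbourhood on which all small [d] work. *)
Lemma within_continuous_unif {R : realType} {f : R -> R} {K : set R} {e : R} :
  compact K -> {within K, continuous f} -> 0 < e ->
  exists2 d : R, 0 < d & forall x y, K x -> K y -> `|x - y| < d ->
    `|f x - f y| < e.
Proof.
move=> /compact_near_coveringP/near_covering_withinP cK.
move=> /subspace_continuousP cf e0.
have : \forall d \near 0^'+, K `<=` (fun x => forall y, K y -> `|x - y| < d ->
    `|f x - f y| < e).
  apply: cK => x Kx.
  have e20 : 0 < e / 2 by rewrite divr_gt0.
  have /cvgrPdist_lt/(_ _ e20) := cf x Kx.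
  rewrite near_withinE => /nbhs_ballP[r /= r0 xr].
  (* Halving [r] keeps every [y] within [d] of [x'] inside the [r]-ball about [x], so [f x'] and
     [f y] are both [e / 2]-close to [f x]. *)
  have r20 : 0 < r / 2 by rewrite divr_gt0.
  near=> x' d => /= Kx' y Ky x'y.
  have xx' : `|x - x'| < r / 2.
    by near: x'; exact: nbhsx_ballx.
  have dr : d < r / 2 by near: d; exact: nbhs_right_lt.
  have xy : `|x - y| < r.
    have := ler_distD x' x y; lra.
  have fx' : `|f x - f x'| < e / 2 by apply: xr => //=; apply: lt_trans xx' _; lra.
  have fy : `|f x - f y| < e / 2 by exact: xr.
  have := ler_distD (f x) (f x') (f y); rewrite [`|f x' - f x|]distrC; lra.
move=> Pd; near (0 : R)^'+ => d; exists d => // x y Kx Ky.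
by apply: (near Pd d).
Unshelve. all: by end_near. Qed.

(** Points closer than the modulus [d] are handled by [e] alone; for the others
    [(x - y)^2 / d^2 >= 1], so the quadratic term absorbs twice a bound on [|f|]. *)
Lemma within_continuous_dist_sqr {R : realType} {f : R -> R} {K : set R}
    {e : R} :
  compact K -> {within K, continuous f} -> 0 < e ->
  exists2 C : R, 0 <= C & forall x y, K x -> K y ->
    `|f x - f y| <= e + C * (x - y) ^+ 2.
Proof.
move=> cK cf e0; have [d d0 fd] := within_continuous_unif cK cf e0.
have /compact_bounded[M [_ fM]] := continuous_compact cf cK.
(* Boundedness is given for every real strictly above [M]; [|M| + 1] is one that is also
   nonnegative. *)
have {}fM x : K x -> `|f x| <= `|M| + 1.
  by move=> Kx; apply: (fM (`|M| + 1)); [rewrite ltr_pwDr// ler_norm | exists x].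
have M0 : 0 <= 2 * (`|M| + 1) by rewrite mulr_ge0 ?addr_ge0.
have C0 : 0 <= 2 * (`|M| + 1) / d ^+ 2 by rewrite divr_ge0 ?sqr_ge0.
exists (2 * (`|M| + 1) / d ^+ 2) => // x y Kx Ky.
have [/(fd _ _ Kx Ky)/ltW/le_trans|dxy] := ltP `|x - y| d.
  by apply; rewrite lerDl mulr_ge0 ?sqr_ge0.
have d2 : 1 <= (x - y) ^+ 2 / d ^+ 2.
  by rewrite ler_pdivlMr ?exprn_gt0 // mul1r -[leRHS]real_normK ?num_real //
     lerXn2r // nnegrE ltW.
apply: (@le_trans _ _ (2 * (`|M| + 1))).
  have := ler_normB (f x) (f y); have := fM _ Kx; have := fM _ Ky; lra.
rewrite mulrAC -mulrA.
apply: (@le_trans _ _ (2 * (`|M| + 1) * ((x - y) ^+ 2 / d ^+ 2))).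
  by rewrite ler_peMr.
by rewrite lerDr ltW.
Qed.

(** The right-hand side does not depend on [x], which is what makes the convergence uniform. *)
Lemma bernstein_stancu_dist {R : realType} {alpha beta e C : R} {n : nat}
    {f : R -> R} {x : R} :
  0 <= alpha -> alpha <= beta -> 0 <= C -> (0 < n)%N -> 0 <= x <= 1 ->
  (forall t, 0 <= t <= 1 -> `|f x - f t| <= e + C * (x - t) ^+ 2) ->
  `|f x - bernstein_stancu alpha beta n f x| <= e + C * (1 + beta ^+ 2) / n%:R.
Proof.
move=> a0 ab C0 n0 x01 fC.
have N0 : 0 < n%:R :> R by rewrite ltr0n.
have nb0 : 0 < n%:R + beta by lra.
(* Since the weights sum to 1, the error is a weighted average of the differences between [f x] and
   the values of [f] at the nodes. *)
rewrite -[f x]mul1r -(sum_bernstein_basis n x) mulr_suml -sumrB.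
under eq_bigr do rewrite -mulrBr.
apply: (le_trans (ler_norm_sum _ _ _)).
pose c := (n%:R + beta) * x - alpha.
apply: (@le_trans _ _ (\sum_(k < n.+1) (bernstein_basis n k x * e +
    C / (n%:R + beta) ^+ 2 * (bernstein_basis n k x * (k%:R - c) ^+ 2)))).
  apply: ler_sum => k _.
  have b0 := bernstein_basis_ge0 n k x01.
  rewrite normrM ger0_norm //.
  apply: (le_trans (ler_wpM2l b0 (fC _ _))).
    have kn : k%:R <= n%:R :> R by rewrite ler_nat -ltnS.
    have k0 : 0 <= k%:R :> R by [].
    rewrite divr_ge0 ?ler_pdivrMr //; lra.
  rewrite le_eqVlt; apply/orP; left; apply/eqP; rewrite /c; field.
  by rewrite gt_eqF.
rewrite big_split /= -mulr_suml sum_bernstein_basis mul1r -mulr_sumr.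
rewrite sum_bernstein_basis_sqr lerD2l.
rewrite -!mulrA ler_wpM2l // mulrC ler_pdivrMr ?exprn_gt0 //.
have -> : n%:R * x - c = alpha - beta * x by rewrite /c; ring.
have n1 : 1 <= n%:R :> R by rewrite ler1n.
have [x0 x1] := andP x01.
(* Both [alpha] and [beta * x] lie in [[0, beta]], so the moment is at most [n + beta^2], and
   [n >= 1] gives this bound. *)
apply: (@le_trans _ _ ((1 + beta ^+ 2) * n%:R)).
  have : x * (1 - x) <= 1 by nra.
  have : (alpha - beta * x) ^+ 2 <= beta ^+ 2.
    have bx0 : 0 <= beta * x by rewrite mulr_ge0 //; lra.
    have bx1 : beta * x <= beta by rewrite ler_piMr //; lra.
    rewrite -[leLHS]real_normK ?num_real // lerXn2r ?nnegrE //; first lra.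
    by rewrite ler_norml; apply/andP; split; lra.
  have : 0 <= beta ^+ 2 by exact: sqr_ge0.
  by nra.
(* What remains is [n^2 <= (n + beta)^2]. *)
rewrite mulrAC ler_pdivlMr // -mulrA ler_wpM2l ?addr_ge0 ?sqr_ge0 //.
by rewrite -expr2 lerXn2r ?nnegrE; lra.
Qed.

Theorem corollary1 (R : realType) (alpha beta : R)
  (alpha_ge0 : 0 <= alpha) (le_alpha_beta : alpha <= beta)
  (f : R -> R) (cf : {within `[0, 1], continuous f}) :
  {uniform `[0, 1], (fun n : nat => bernstein_stancu alpha beta n.+1 f) @ \oo
     --> f}.
Proof.
move=> P /uniform_nbhs[E [/= entE EP]].
move: entE; rewrite -entourage_ballE => -[e /= e0 eE].
have e20 : 0 < e / 2 by rewrite divr_gt0.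
have [C C0 fC] := within_continuous_dist_sqr (@segment_compact R 0 1) cf e20.
(* The added 1 keeps the divisor positive even when [C = 0]. *)
have D0 : 0 < C * (1 + beta ^+ 2) + 1.
  by rewrite ltr_wpDl // mulr_ge0 // addr_ge0 ?sqr_ge0.
have d0 : 0 < e / 2 / (C * (1 + beta ^+ 2) + 1) by rewrite divr_gt0.
(* The index [n] is fixed before [x]: half of [e] pays for the modulus term, and the other half for
   the [1 / n.+1] term. *)
near=> n; apply: EP => x /= x01; apply: eE; rewrite /= /ball /=.
apply: (le_lt_trans (bernstein_stancu_dist alpha_ge0 le_alpha_beta C0
  (ltn0Sn n) _ _)).
- by move: x01; rewrite in_itv.
- by move=> t t01; apply: fC => //=; rewrite in_itv.
have : n.+1%:R^-1 < e / 2 / (C * (1 + beta ^+ 2) + 1).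
  by near: n; exact: (near_infty_natSinv_lt (PosNum d0)).
rewrite ltr_pdivlMr // => nd.
rewrite -ltrBrDl [X in X - _](splitr e) addrK.
by apply: lt_trans nd; rewrite mulrC ltr_pM2l ?invr_gt0 // ltrDl.
Unshelve. all: by end_near. Qed.
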